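(* Let $k_0,k_1,k_2,k_3$ be nonzero scalars in $\mathbb{F}$. If $V$ is an $\mathfrak{H}_q$-module which contains a vector $v$ satisfying $$t_0v=k_0v,\qquad t_3v=k_3v,\qquad c_1v=(k_1+k_1^{-1})v,\qquad c_2v=(k_2+k_2^{-1})v,$$ then there exists a unique $\mathfrak{H}_q$-module homomorphism $M(k_0,k_1,k_2,k_3)\to V$ that sends $m_0$ to $v$.
   Context: $\mathbb{F}$ is a field and $q\in\mathbb{F}$ is nonzero. The universal DAHA $\mathfrak{H}_q$ of type $(C_1^\vee,C_1)$ is the unital associative $\mathbb{F}$-algebra with generators $t_0^{\pm1},t_1^{\pm1},t_2^{\pm1},t_3^{\pm1}$ and relations: $t_it_i^{-1}=t_i^{-1}t_i=1$ for all $i$; $t_i+t_i^{-1}$ is central for all $i$; $t_0t_1t_2t_3=q^{-1}$. Put $c_i=t_i+t_i^{-1}$. For nonzero $k_0,k_1,k_2,k_3\in\mathbb{F}$, $M(k_0,k_1,k_2,k_3)$ denotes the $\mathfrak{H}_q$-module with $\mathbb{F}$-basis $\{m_i\}_{i=0}^\infty$ and action - $t_0m_i=k_0^{-1}q^{-i}(1-q^i)(1-k_0^2q^i)m_{i-1}+(k_0+k_0^{-1}-k_0^{-1}q^{-i})m_i$ for $i=2,4,\ldots$; $t_0m_i=k_0^{-1}q^{-i-1}(m_i-m_{i+1})$ for $i=1,3,\ldots$; $t_0m_0=k_0m_0$; - $t_1m_i=-k_1(1-q^i)(1-k_0^2q^i)m_{i-1}+k_1m_i+k_1^{-1}m_{i+1}$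 for $i=2,4,\ldots$; $t_1m_i=k_1^{-1}m_i$ for $i=1,3,\ldots$; $t_1m_0=k_1m_0+k_1^{-1}m_1$; - $t_2m_i=k_0^{-1}k_1^{-1}k_3^{-1}q^{-i-1}(m_i-m_{i+1})$ for $i=0,2,\ldots$; $t_2m_i=\frac{(k_0k_1k_3q^i-k_2)(k_0k_1k_3q^i-k_2^{-1})}{k_0k_1k_3q^i}m_{i-1}+(k_2+k_2^{-1}-k_0^{-1}k_1^{-1}k_3^{-1}q^{-i})m_i$ for $i=1,3,\ldots$; - $t_3m_i=k_3m_i$ for $i=0,2,\ldots$; $t_3m_i=-k_3^{-1}(k_0k_1k_3q^i-k_2)(k_0k_1k_3q^i-k_2^{-1})m_{i-1}+k_3^{-1}m_i+k_3m_{i+1}$ for $i=1,3,\ldots$. (These formulas do define an $\mathfrak{H}_q$-module.) *)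

(* Defs.v *)
From HB Require Import structures.
From mathcomp Require Import all_boot all_order all_algebra.
From mathcomp Require Import generic_quotient ring.
From mathcomp Require Import boolp.

Set Implicit Arguments.
Unset Strict Implicit.
Unset Printing Implicit Defensive.

Import GRing.Theory.
Local Open Scope ring_scope.
Local Open Scope quotient_scope.

(* Unital associative F-algebras given by generators and relations: terms in
   the generators modulo the least congruence containing the axioms of
   F-algebras and the relations. *)

Section Presentation.

Variables (F : fieldType) (X : Type).

Inductive alg_term : Type :=
| TGen of X
| TScal of F
| TAdd of alg_term & alg_term
| TMul of alg_term & alg_term.

HB.instance Definition _ := gen_eqMixin alg_term.
HB.instance Definition _ := gen_choiceMixin alg_term.

Variable rel : alg_term -> alg_term -> Prop.

Inductive alg_congr : alg_term -> alg_term -> Prop :=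
| congr_rel x y : rel x y -> alg_congr x y
| congr_refl x : alg_congr x x
| congr_sym x y : alg_congr x y -> alg_congr y x
| congr_trans x y z : alg_congr x y -> alg_congr y z -> alg_congr x z
| congr_add x x' y y' :
    alg_congr x x' -> alg_congr y y' -> alg_congr (TAdd x y) (TAdd x' y')
| congr_mul x x' y y' :
    alg_congr x x' -> alg_congr y y' -> alg_congr (TMul x y) (TMul x' y')
| congr_addA x y z : alg_congr (TAdd x (TAdd y z)) (TAdd (TAdd x y) z)
| congr_addC x y : alg_congr (TAdd x y) (TAdd y x)
| congr_add0 x : alg_congr (TAdd (TScal 0) x) x
| congr_addN x : alg_congr (TAdd (TMul (TScal (-1)) x) x) (TScal 0)
| congr_mulA x y z : alg_congr (TMul x (TMul y z)) (TMul (TMul x y) z)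
| congr_mul1l x : alg_congr (TMul (TScal 1) x) x
| congr_mul1r x : alg_congr (TMul x (TScal 1)) x
| congr_mulDl x y z :
    alg_congr (TMul (TAdd x y) z) (TAdd (TMul x z) (TMul y z))
| congr_mulDr x y z :
    alg_congr (TMul x (TAdd y z)) (TAdd (TMul x y) (TMul x z))
| congr_scalD a b : alg_congr (TScal (a + b)) (TAdd (TScal a) (TScal b))
| congr_scalM a b : alg_congr (TScal (a * b)) (TMul (TScal a) (TScal b))
| congr_scalC a x : alg_congr (TMul (TScal a) x) (TMul x (TScal a)).

Definition alg_congrb (x y : alg_term) : bool := `[< alg_congr x y >].

Lemma alg_congrb_equiv : equiv_class_of alg_congrb.
Proof.
split.
- by move=> x; apply/asboolP; apply: congr_refl.
- by move=> x y; apply/asboolP/asboolP; apply: congr_sym.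
- move=> y x z /asboolP h1 /asboolP h2.
  by apply/asboolP; apply: congr_trans h1 h2.
Qed.

Canonical alg_congr_equiv := EquivRelPack alg_congrb_equiv.

Definition presAlg : Type := {eq_quot alg_congr_equiv}.
HB.instance Definition _ := Choice.on presAlg.

Definition palg_pi (x : alg_term) : presAlg :=
  \pi_({eq_quot alg_congr_equiv}) x.
Definition palg_repr (x : presAlg) : alg_term :=
  repr (x : {eq_quot alg_congr_equiv}).

Lemma palg_reprK x : palg_pi (palg_repr x) = x.
Proof. exact: reprK. Qed.

Lemma palg_piP x y : palg_pi x = palg_pi y <-> alg_congr x y.
Proof.
split.
- by move=> /eqmodP /asboolP.
- by move=> h; apply/eqmodP; apply/asboolP.
Qed.

Lemma palg_repr_pi x : alg_congr (palg_repr (palg_pi x)) x.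
Proof. by apply/palg_piP; rewrite palg_reprK. Qed.

Lemma palg_surj (P : presAlg -> Prop) :
  (forall x, P (palg_pi x)) -> forall x, P x.
Proof. by move=> h x; rewrite -(palg_reprK x). Qed.

Definition palg_add (x y : presAlg) : presAlg :=
  palg_pi (TAdd (palg_repr x) (palg_repr y)).
Definition palg_mul (x y : presAlg) : presAlg :=
  palg_pi (TMul (palg_repr x) (palg_repr y)).
Definition palg_opp (x : presAlg) : presAlg :=
  palg_mul (palg_pi (TScal (-1))) x.

Lemma palg_addE x y : palg_add (palg_pi x) (palg_pi y) = palg_pi (TAdd x y).
Proof. by apply/palg_piP; apply: congr_add; apply: palg_repr_pi. Qed.

Lemma palg_mulE x y : palg_mul (palg_pi x) (palg_pi y) = palg_pi (TMul x y).
Proof. by apply/palg_piP; apply: congr_mul; apply: palg_repr_pi. Qed.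

Lemma palg_addA : associative palg_add.
Proof.
elim/palg_surj=> x; elim/palg_surj=> y; elim/palg_surj=> z.
by rewrite !palg_addE; apply/palg_piP; apply: congr_addA.
Qed.

Lemma palg_addC : commutative palg_add.
Proof.
elim/palg_surj=> x; elim/palg_surj=> y.
by rewrite !palg_addE; apply/palg_piP; apply: congr_addC.
Qed.

Lemma palg_add0 : left_id (palg_pi (TScal 0)) palg_add.
Proof.
by elim/palg_surj=> x; rewrite palg_addE; apply/palg_piP; apply: congr_add0.
Qed.

Lemma palg_addN : left_inverse (palg_pi (TScal 0)) palg_opp palg_add.
Proof.
elim/palg_surj=> x; rewrite /palg_opp palg_mulE palg_addE.
by apply/palg_piP; apply: congr_addN.
Qed.

HB.instance Definition _ := GRing.isZmodule.Build presAlg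
  palg_addA palg_addC palg_add0 palg_addN.

Lemma palg_mulA : associative palg_mul.
Proof.
elim/palg_surj=> x; elim/palg_surj=> y; elim/palg_surj=> z.
by rewrite !palg_mulE; apply/palg_piP; apply: congr_mulA.
Qed.

Lemma palg_mul1l : left_id (palg_pi (TScal 1)) palg_mul.
Proof.
by elim/palg_surj=> x; rewrite palg_mulE; apply/palg_piP; apply: congr_mul1l.
Qed.

Lemma palg_mul1r : right_id (palg_pi (TScal 1)) palg_mul.
Proof.
by elim/palg_surj=> x; rewrite palg_mulE; apply/palg_piP; apply: congr_mul1r.
Qed.

Lemma palg_mulDl : left_distributive palg_mul palg_add.
Proof.
elim/palg_surj=> x; elim/palg_surj=> y; elim/palg_surj=> z.
rewrite !(palg_addE, palg_mulE); apply/palg_piP; exact: congr_mulDl.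
Qed.

Lemma palg_mulDr : right_distributive palg_mul palg_add.
Proof.
elim/palg_surj=> x; elim/palg_surj=> y; elim/palg_surj=> z.
rewrite !(palg_addE, palg_mulE); apply/palg_piP; exact: congr_mulDr.
Qed.

HB.instance Definition _ := GRing.Zmodule_isPzRing.Build presAlg
  palg_mulA palg_mul1l palg_mul1r palg_mulDl palg_mulDr.

Definition palg_scale (a : F) (x : presAlg) : presAlg := palg_pi (TScal a) * x.

Lemma palg_piD x y : palg_pi (TAdd x y) = palg_pi x + palg_pi y.
Proof. by rewrite -palg_addE. Qed.

Lemma palg_piM x y : palg_pi (TMul x y) = palg_pi x * palg_pi y.
Proof. by rewrite -palg_mulE. Qed.

Lemma palg_scalD a b :
  palg_pi (TScal (a + b)) = palg_pi (TScal a) + palg_pi (TScal b).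
Proof. by rewrite -palg_piD; apply/palg_piP; apply: congr_scalD. Qed.

Lemma palg_scalM a b :
  palg_pi (TScal (a * b)) = palg_pi (TScal a) * palg_pi (TScal b).
Proof. by rewrite -palg_piM; apply/palg_piP; apply: congr_scalM. Qed.

Lemma palg_scalC a x : palg_pi (TScal a) * x = x * palg_pi (TScal a).
Proof.
elim/palg_surj: x => x; rewrite -!palg_piM.
by apply/palg_piP; apply: congr_scalC.
Qed.

Lemma palg_scalerA a b x :
  palg_scale a (palg_scale b x) = palg_scale (a * b) x.
Proof. by rewrite /palg_scale palg_scalM mulrA. Qed.

Lemma palg_scale1r : left_id 1 palg_scale.
Proof. by move=> x; rewrite /palg_scale mul1r. Qed.

Lemma palg_scalerDr : right_distributive palg_scale +%R.
Proof. by move=> a x y; rewrite /palg_scale mulrDr. Qed.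

Lemma palg_scalerDl x : {morph palg_scale^~ x : a b / a + b}.
Proof. by move=> a b; rewrite /palg_scale palg_scalD mulrDl. Qed.

HB.instance Definition _ := GRing.Zmodule_isLmodule.Build F presAlg
  palg_scalerA palg_scale1r palg_scalerDr palg_scalerDl.

Lemma palg_scaleE (a : F) (x : presAlg) : a *: x = palg_pi (TScal a) * x.
Proof. by []. Qed.

(* An assignment of F-linear operators to the generators that respects the
   relations makes V a module over the presented algebra. *)

Section Action.

Variables (V : lmodType F) (f : X -> {linear V -> V}).

Fixpoint term_act (x : alg_term) : V -> V :=
  match x with
  | TGen i => f i
  | TScal a => fun v => a *: v
  | TAdd x y => fun v => term_act x v + term_act y v
  | TMul x y => fun v => term_act x (term_act y v)
  end.

Lemma term_actD x : {morph term_act x : u v / u + v}.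
Proof.
elim: x => [i|a|x IHx y IHy|x IHx y IHy] u v /=.
- exact: linearD.
- exact: scalerDr.
- by rewrite IHx IHy addrACA.
- by rewrite IHy IHx.
Qed.

Lemma term_actZ x a v : term_act x (a *: v) = a *: term_act x v.
Proof.
elim: x v => [i|b|x IHx y IHy|x IHx y IHy] v /=.
- exact: linearZ.
- by rewrite !scalerA mulrC.
- by rewrite IHx IHy scalerDr.
- by rewrite IHy IHx.
Qed.

Hypothesis frel : forall x y, rel x y -> term_act x =1 term_act y.

Lemma term_act_congr x y : alg_congr x y -> term_act x =1 term_act y.
Proof.
elim=> {x y} /=.
- exact: frel.
- by [].
- by move=> x y _ IH v.
- by move=> x y z _ IH1 _ IH2 v; rewrite IH1 IH2.
- by move=> x x' y y' _ IH1 _ IH2 v; rewrite IH1 IH2.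
- by move=> x x' y y' _ IH1 _ IH2 v; rewrite IH2 IH1.
- by move=> x y z v; rewrite addrA.
- by move=> x y v; rewrite addrC.
- by move=> x v; rewrite scale0r add0r.
- by move=> x v; rewrite scaleN1r addNr scale0r.
- by [].
- by move=> x v; rewrite scale1r.
- by move=> x v; rewrite scale1r.
- by [].
- by move=> x y z v; rewrite term_actD.
- by move=> a b v; rewrite scalerDl.
- by move=> a b v; rewrite scalerA.
- by move=> a x v; rewrite term_actZ.
Qed.

Definition palg_act (x : presAlg) (v : V) : V := term_act (palg_repr x) v.

Lemma palg_actE x v : palg_act (palg_pi x) v = term_act x v.
Proof. exact: (term_act_congr (palg_repr_pi x)). Qed.

Lemma palg_actA x y v : palg_act x (palg_act y v) = palg_act (x * y) v.
Proof.
by elim/palg_surj: x => x; elim/palg_surj: y => y; rewrite -palg_piM !palg_actE.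
Qed.

Lemma palg_act1 : left_id 1 palg_act.
Proof. by move=> v; rewrite palg_actE /= scale1r. Qed.

Lemma palg_actDr : right_distributive palg_act +%R.
Proof. by move=> x u v; rewrite /palg_act term_actD. Qed.

Lemma palg_actDl v : {morph palg_act^~ v : x y / x + y}.
Proof.
by elim/palg_surj=> x; elim/palg_surj=> y; rewrite -palg_piD !palg_actE.
Qed.

End Action.

End Presentation.

Arguments TGen {F X}.
Arguments TScal {F X}.

(* TGen (i, true) stands for t_i and TGen (i, false) for t_i^{-1}. *)

Definition daha_term (F : fieldType) : Type := alg_term F ('I_4 * bool).

Section DahaRelations.

Variables (F : fieldType) (q : F).

Let T (i : 'I_4) : daha_term F := TGen (i, true).
Let TV (i : 'I_4) : daha_term F := TGen (i, false).

Inductive daha_rel : daha_term F -> daha_term F -> Prop :=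
| daha_rel_tV i : daha_rel (TMul (T i) (TV i)) (TScal 1)
| daha_rel_Vt i : daha_rel (TMul (TV i) (T i)) (TScal 1)
| daha_rel_central i x :
    daha_rel (TMul (TAdd (T i) (TV i)) x) (TMul x (TAdd (T i) (TV i)))
| daha_rel_prod :
    daha_rel (TMul (TMul (TMul (T 0) (T 1)) (T 2)) (T 3)) (TScal q^-1).

End DahaRelations.

(* The space with basis m_i = 'X^i (i in nat). *)

Section DahaMOperators.

Variables (F : fieldType) (q k0 k1 k2 k3 : F).

Local Notation m i := ('X^i : {poly F}).

Definition dahaM_t0 (i : nat) : {poly F} :=
  if i == 0%N then k0 *: m 0
  else if odd i then (k0^-1 * q ^- i.+1) *: (m i - m i.+1)
  else (k0^-1 * q ^- i * (1 - q ^+ i) * (1 - k0 ^+ 2 * q ^+ i)) *: m i.-1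
       + (k0 + k0^-1 - k0^-1 * q ^- i) *: m i.

Definition dahaM_t1 (i : nat) : {poly F} :=
  if i == 0%N then k1 *: m 0 + k1^-1 *: m 1
  else if odd i then k1^-1 *: m i
  else - (k1 * (1 - q ^+ i) * (1 - k0 ^+ 2 * q ^+ i)) *: m i.-1
       + k1 *: m i + k1^-1 *: m i.+1.

Definition dahaM_t2 (i : nat) : {poly F} :=
  if odd i then
    ((k0 * k1 * k3 * q ^+ i - k2) * (k0 * k1 * k3 * q ^+ i - k2^-1)
      / (k0 * k1 * k3 * q ^+ i)) *: m i.-1
    + (k2 + k2^-1 - k0^-1 * k1^-1 * k3^-1 * q ^- i) *: m i
  else (k0^-1 * k1^-1 * k3^-1 * q ^- i.+1) *: (m i - m i.+1).

Definition dahaM_t3 (i : nat) : {poly F} :=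
  if odd i then
    - (k3^-1 * (k0 * k1 * k3 * q ^+ i - k2) * (k0 * k1 * k3 * q ^+ i - k2^-1))
      *: m i.-1
    + k3^-1 *: m i + k3 *: m i.+1
  else k3 *: m i.

Definition dahaM_t (i : 'I_4) : nat -> {poly F} :=
  match val i with
  | 0 => dahaM_t0
  | 1 => dahaM_t1
  | 2 => dahaM_t2
  | _ => dahaM_t3
  end.

Definition dahaM_k (i : 'I_4) : F :=
  match val i with 0 => k0 | 1 => k1 | 2 => k2 | _ => k3 end.

Definition lin_ext (b : nat -> {poly F}) (p : {poly F}) : {poly F} :=
  \sum_(i < size p) p`_i *: b i.

Lemma lin_ext_widen b (p : {poly F}) n : (size p <= n)%N ->
  lin_ext b p = \sum_(i < n) p`_i *: b i.
Proof.
move=> hn; rewrite /lin_ext (big_ord_widen _ (fun i => p`_i *: b i) hn).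
rewrite big_mkcond; apply: eq_bigr => i _.
by case: ltnP => // h; rewrite nth_default ?scale0r.
Qed.

Lemma lin_ext_is_linear b : linear (lin_ext b).
Proof.
move=> a p r.
set n := maxn (size (a *: p + r)) (maxn (size p) (size r)).
rewrite !(@lin_ext_widen b _ n) ?leq_max ?leqnn ?orbT //.
rewrite scaler_sumr -big_split /=; apply: eq_bigr => i _.
by rewrite coefD coefZ scalerDl scalerA.
Qed.

HB.instance Definition _ b :=
  GRing.isLinear.Build F {poly F} {poly F} _ (lin_ext b) (lin_ext_is_linear b).

Lemma lin_extXn b i : lin_ext b 'X^i = b i.
Proof.
rewrite /lin_ext size_polyXn big_ord_recr /= big1 ?add0r ?coefXn ?eqxx ?scale1r //.
by move=> j _; rewrite coefXn ltn_eqF ?scale0r.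
Qed.

(* The operator of t_i has eigenvalues k_i, k_i^{-1}; this yields its inverse
   (see dahaM_op_rel). *)

Definition dahaM_opV (i : 'I_4) (p : {poly F}) : {poly F} :=
  (dahaM_k i + (dahaM_k i)^-1) *: p - lin_ext (dahaM_t i) p.

Lemma dahaM_opV_is_linear i : linear (dahaM_opV i).
Proof.
move=> a p r; rewrite /dahaM_opV lin_ext_is_linear.
rewrite scalerDr scalerBr !scalerA [a * _]mulrC opprD.
exact: addrACA.
Qed.

HB.instance Definition _ i :=
  GRing.isLinear.Build F {poly F} {poly F} _ (dahaM_opV i)
    (dahaM_opV_is_linear i).

Definition dahaM_op (g : 'I_4 * bool) : {linear {poly F} -> {poly F}} :=
  if g.2 then lin_ext (dahaM_t g.1) : {linear {poly F} -> {poly F}}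
  else dahaM_opV g.1.

Hypotheses (hq : q != 0) (hk0 : k0 != 0) (hk1 : k1 != 0) (hk2 : k2 != 0)
  (hk3 : k3 != 0).

Lemma lin_ext_eq (f g : {linear {poly F} -> {poly F}}) :
  (forall i, f 'X^i = g 'X^i) -> f =1 g.
Proof.
move=> h p; rewrite -[p]coefK poly_def !linear_sum; apply: eq_bigr => i _.
by rewrite !linearZ h.
Qed.

Lemma ord4_ind (P : 'I_4 -> Prop) : P 0 -> P 1 -> P 2 -> P 3 -> forall i, P i.
Proof.
move=> p0 p1 p2 p3 [[|[|[|[|//]]]] hi].
- by rewrite (_ : Ordinal hi = 0) //; apply: val_inj.
- by rewrite (_ : Ordinal hi = 1) //; apply: val_inj.
- by rewrite (_ : Ordinal hi = 2) //; apply: val_inj.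
- by rewrite (_ : Ordinal hi = 3) //; apply: val_inj.
Qed.

Section Relations.

Variable b : nat -> {poly F}.

Variables T0 T1 T2 T3 : {linear {poly F} -> {poly F}}.

Let a0 i := k0^-1 * q ^- i * (1 - q ^+ i) * (1 - k0 ^+ 2 * q ^+ i).
Let b0 i := k0 + k0^-1 - k0^-1 * q ^- i.
Let d0 i := k0^-1 * q ^- i.+1.
Let a1 i := - (k1 * (1 - q ^+ i) * (1 - k0 ^+ 2 * q ^+ i)).
Let a2 i := (k0 * k1 * k3 * q ^+ i - k2) * (k0 * k1 * k3 * q ^+ i - k2^-1)
  / (k0 * k1 * k3 * q ^+ i).
Let b2 i := k2 + k2^-1 - k0^-1 * k1^-1 * k3^-1 * q ^- i.
Let d2 i := k0^-1 * k1^-1 * k3^-1 * q ^- i.+1.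
Let a3 i :=
  - (k3^-1 * (k0 * k1 * k3 * q ^+ i - k2) * (k0 * k1 * k3 * q ^+ i - k2^-1)).

(* At i = 0 the coefficients of b i.-1 vanish. *)
Hypothesis T0E : forall i, T0 (b i) =
  if odd i then d0 i *: (b i - b i.+1) else a0 i *: b i.-1 + b0 i *: b i.
Hypothesis T1E : forall i, T1 (b i) =
  if odd i then k1^-1 *: b i
  else a1 i *: b i.-1 + k1 *: b i + k1^-1 *: b i.+1.
Hypothesis T2E : forall i, T2 (b i) =
  if odd i then a2 i *: b i.-1 + b2 i *: b i else d2 i *: (b i - b i.+1).
Hypothesis T3E : forall i, T3 (b i) =
  if odd i then a3 i *: b i.-1 + k3^-1 *: b i + k3 *: b i.+1 else k3 *: b i.

Let TD (T : {linear {poly F} -> {poly F}}) u v : T (u + v) = T u + T v.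
Proof. exact: linearD. Qed.
Let TN (T : {linear {poly F} -> {poly F}}) u : T (- u) = - T u.
Proof. exact: linearN. Qed.
Let TZ (T : {linear {poly F} -> {poly F}}) a u : T (a *: u) = a *: T u.
Proof. exact: linearZ. Qed.

Let linE := (TD T0, TN T0, TZ T0, TD T1, TN T1, TZ T1,
  TD T2, TN T2, TZ T2, TD T3, TN T3, TZ T3).

Lemma even_odd_cases (P : nat -> Prop) :
  P 0%N -> (forall n, odd n -> P n.+1) -> (forall n, ~~ odd n -> P n.+1) ->
  forall n, P n.
Proof. by move=> p0 podd peven [//|n]; case: (boolP (odd n)); auto. Qed.

Let qX n : q ^+ n != 0. Proof. by rewrite expf_neq0. Qed.

Ltac expand_op o :=
  do ?[rewrite !(T0E, T1E, T2E, T3E) /= ?negbK ?o /= ?linE].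
Ltac solve_coef n :=
  let Q := fresh "Q" in let hQ := fresh "hQ" in let u := fresh "u" in
  rewrite /a0 /b0 /d0 /a1 /a2 /b2 /d2 /a3;
  move: (qX n); rewrite ?exprS ?expr0; move: (q ^+ n) => Q hQ;
  apply/polyP => u; rewrite !(coefD, coefN, coefZ);
  field; rewrite ?oner_eq0 ?hQ ?hk0 ?hk1 ?hk2 ?hk3 ?hq.

Lemma dahaM_quad0 n : T0 (T0 (b n)) = (k0 + k0^-1) *: T0 (b n) - b n.
Proof.
move: n; apply: even_odd_cases => [|n o|n /negbTE o].
- by expand_op (erefl (odd 0)); solve_coef 0%N.
- by expand_op o; solve_coef n.
- by expand_op o; solve_coef n.
Qed.

Lemma dahaM_quad1 n : T1 (T1 (b n)) = (k1 + k1^-1) *: T1 (b n) - b n.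
Proof.
move: n; apply: even_odd_cases => [|n o|n /negbTE o].
- by expand_op (erefl (odd 0)); solve_coef 0%N.
- by expand_op o; solve_coef n.
- by expand_op o; solve_coef n.
Qed.

Lemma dahaM_quad2 n : T2 (T2 (b n)) = (k2 + k2^-1) *: T2 (b n) - b n.
Proof.
move: n; apply: even_odd_cases => [|n o|n /negbTE o].
- by expand_op (erefl (odd 0)); solve_coef 0%N.
- by expand_op o; solve_coef n.
- by expand_op o; solve_coef n.
Qed.

Lemma dahaM_quad3 n : T3 (T3 (b n)) = (k3 + k3^-1) *: T3 (b n) - b n.
Proof.
move: n; apply: even_odd_cases => [|n o|n /negbTE o].
- by expand_op (erefl (odd 0)); solve_coef 0%N.
- by expand_op o; solve_coef n.
- by expand_op o; solve_coef n.
Qed.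

Lemma dahaM_half n : T2 (T3 (b n)) =
  q^-1 *: ((k1 + k1^-1) *: ((k0 + k0^-1) *: b n - T0 (b n))
           - T1 ((k0 + k0^-1) *: b n - T0 (b n))).
Proof.
case: n => [|[|n]]; last case: (boolP (odd n)) => [o|/negbTE o].
- expand_op (erefl (odd 0)). by solve_coef 0%N.
- expand_op (erefl (odd 0)). by solve_coef 0%N.
- expand_op o. by solve_coef n.
- expand_op o. by solve_coef n.
Qed.

End Relations.

Let L i : {linear {poly F} -> {poly F}} := lin_ext (dahaM_t i).

Let LX i n : L i (m n) = dahaM_t i n.
Proof. exact: lin_extXn. Qed.

Let L0E i : L 0 (m i) =
  if odd i then (k0^-1 * q ^- i.+1) *: (m i - m i.+1)
  else (k0^-1 * q ^- i * (1 - q ^+ i) * (1 - k0 ^+ 2 * q ^+ i)) *: m i.-1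
       + (k0 + k0^-1 - k0^-1 * q ^- i) *: m i.
Proof.
rewrite LX /dahaM_t /= /dahaM_t0; case: eqP => // -> /=.
rewrite expr0 invr1 subrr mulr0 mul0r scale0r add0r.
by rewrite mulr1 addrK.
Qed.

Let L1E i : L 1 (m i) =
  if odd i then k1^-1 *: m i
  else - (k1 * (1 - q ^+ i) * (1 - k0 ^+ 2 * q ^+ i)) *: m i.-1
       + k1 *: m i + k1^-1 *: m i.+1.
Proof.
rewrite LX /dahaM_t /= /dahaM_t1; case: eqP => // -> /=.
by rewrite expr0 subrr mulr0 mul0r oppr0 scale0r add0r.
Qed.

Lemma dahaM_quad i p :
  L i (L i p) = (dahaM_k i + (dahaM_k i)^-1) *: L i p - p.
Proof.
suff h n : L i (L i (m n)) = (dahaM_k i + (dahaM_k i)^-1) *: L i (m n) - m n.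
  have := @lin_ext_eq (L i \o L i)
    ((dahaM_k i + (dahaM_k i)^-1) \*: L i \- idfun) h; exact.
move: i; apply: ord4_ind.
- exact: (dahaM_quad0 L0E).
- exact: (dahaM_quad1 L1E).
- exact: (dahaM_quad2 (LX 2)).
- exact: (dahaM_quad3 (LX 3)).
Qed.

Lemma dahaM_prod p : L 0 (L 1 (L 2 (L 3 p))) = q^-1 *: p.
Proof.
have half r : L 2 (L 3 r) = q^-1 *: dahaM_opV 1 (dahaM_opV 0 r).
  apply: (@lin_ext_eq (L 2 \o L 3)
    (q^-1 \*: (dahaM_opV 1 \o dahaM_opV 0))) => n.
  exact: (dahaM_half L0E L1E (LX 2) (LX 3)).
have LV i r : L i (dahaM_opV i r) = r.
  by rewrite /dahaM_opV linearB linearZ /= [lin_ext _ (lin_ext _ _)]dahaM_quad subKr.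
by rewrite half !linearZ /= !LV.
Qed.

Lemma dahaM_op_rel x y :
  daha_rel q x y -> term_act dahaM_op x =1 term_act dahaM_op y.
Proof.
have sumE i r : L i r + dahaM_opV i r = (dahaM_k i + (dahaM_k i)^-1) *: r.
  by rewrite /dahaM_opV addrC subrK.
case=> {x y} [i p|i p|i x p|p] /=.
- by rewrite /dahaM_opV linearB linearZ /= [lin_ext _ (lin_ext _ _)]dahaM_quad subKr scale1r.
- by rewrite /dahaM_opV [lin_ext _ (lin_ext _ _)]dahaM_quad subKr scale1r.
- by rewrite [LHS]sumE [_ + dahaM_opV i p]sumE term_actZ.
- exact: dahaM_prod.
Qed.

End DahaMOperators.

Definition daha (F : fieldType) (q : F) (hq : q != 0) : Type :=
  presAlg (daha_rel q).

Section DahaAlgebra.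

Variables (F : fieldType) (q : F) (hq : q != 0).

HB.instance Definition _ := GRing.PzRing.copy (daha hq) (presAlg (daha_rel q)).
HB.instance Definition _ :=
  GRing.Lmodule.copy (daha hq) (presAlg (daha_rel q)).

Lemma daha_oner_neq0 : (1 : daha hq) != 0.
Proof.
have n1 : (1 : F) != 0 := oner_neq0 _.
apply/eqP => /palg_piP /(term_act_congr (dahaM_op_rel hq n1 n1 n1 n1)).
by move=> /(_ 1) /eqP; rewrite /= scale1r scale0r oner_eq0.
Qed.

HB.instance Definition _ :=
  GRing.PzSemiRing_isNonZero.Build (daha hq) daha_oner_neq0.

Lemma daha_scalerAl (a : F) (x y : daha hq) : a *: (x * y) = a *: x * y.
Proof. by rewrite /GRing.scale /= /palg_scale mulrA. Qed.

HB.instance Definition _ :=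
  GRing.Lmodule_isLalgebra.Build F (daha hq) daha_scalerAl.

Lemma daha_scalerAr (a : F) (x y : daha hq) : a *: (x * y) = x * (a *: y).
Proof.
by rewrite /GRing.scale /= /palg_scale !mulrA [x * _](esym (palg_scalC _ _)).
Qed.

HB.instance Definition _ :=
  GRing.Lalgebra_isAlgebra.Build F (daha hq) daha_scalerAr.

Definition daha_t (i : 'I_4) : daha hq := palg_pi (daha_rel q) (TGen (i, true)).
Definition daha_tV (i : 'I_4) : daha hq :=
  palg_pi (daha_rel q) (TGen (i, false)).
Definition daha_c (i : 'I_4) : daha hq := daha_t i + daha_tV i.

Lemma daha_scalE (a : F) : a%:A = palg_pi (daha_rel q) (TScal a) :> daha hq.
Proof. exact: mulr1. Qed.

Lemma daha_mulV i : daha_t i * daha_tV i = 1.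
Proof.
rewrite /daha_t /daha_tV -[LHS]palg_piM; apply/palg_piP/congr_rel.
exact: daha_rel_tV.
Qed.

Lemma daha_mulVt i : daha_tV i * daha_t i = 1.
Proof.
rewrite /daha_t /daha_tV -[LHS]palg_piM; apply/palg_piP/congr_rel.
exact: daha_rel_Vt.
Qed.

Lemma daha_central i (x : daha hq) : daha_c i * x = x * daha_c i.
Proof.
elim/palg_surj: x => x.
rewrite /daha_c /daha_t /daha_tV -[_ + _]palg_piD -[LHS]palg_piM -[RHS]palg_piM.
by apply/palg_piP/congr_rel; apply: daha_rel_central.
Qed.

Lemma daha_prod : daha_t 0 * daha_t 1 * daha_t 2 * daha_t 3 = (q^-1)%:A.
Proof.
have /palg_piP := congr_rel (daha_rel_prod q).
by rewrite daha_scalE !palg_piM.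
Qed.

Lemma daha_ind (P : daha hq -> Prop) :
  (forall a : F, P a%:A) -> (forall i, P (daha_t i)) ->
  (forall i, P (daha_tV i)) -> (forall x y, P x -> P y -> P (x + y)) ->
  (forall x y, P x -> P y -> P (x * y)) -> forall x, P x.
Proof.
move=> hs ht hV hD hM; elim/palg_surj.
elim=> [[i []]|a|x IHx y IHy|x IHx y IHy].
- exact: ht.
- exact: hV.
- by rewrite -daha_scalE.
- by rewrite palg_piD; apply: hD.
- by rewrite palg_piM; apply: hM.
Qed.

End DahaAlgebra.

Definition dahaM (F : fieldType) (q : F) (hq : q != 0) (k0 k1 k2 k3 : F)
    (hk0 : k0 != 0) (hk1 : k1 != 0) (hk2 : k2 != 0) (hk3 : k3 != 0) : Type :=
  {poly F}.

Section DahaM.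

Variables (F : fieldType) (q : F) (hq : q != 0) (k0 k1 k2 k3 : F).
Variables (hk0 : k0 != 0) (hk1 : k1 != 0) (hk2 : k2 != 0) (hk3 : k3 != 0).

Local Notation M := (dahaM hq hk0 hk1 hk2 hk3).

HB.instance Definition _ := GRing.Zmodule.copy M {poly F}.

Let frel := dahaM_op_rel hq hk0 hk1 hk2 hk3.

Definition dahaM_scale (x : daha hq) (p : M) : M :=
  palg_act (dahaM_op q k0 k1 k2 k3) x p.

HB.instance Definition _ := GRing.Zmodule_isLmodule.Build (daha hq) M
  (palg_actA frel : forall x y p,
     dahaM_scale x (dahaM_scale y p) = dahaM_scale (x * y) p)
  (palg_act1 frel) (@palg_actDr _ _ _ _ _) (palg_actDl frel).

Definition dahaM_m (i : nat) : M := 'X^i : {poly F}.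

Lemma dahaM_scalE (a : F) (p : M) : a%:A *: p = (a *: (p : {poly F}) : M).
Proof. by rewrite daha_scalE; apply: (palg_actE frel). Qed.

Lemma dahaM_tE i n :
  daha_t hq i *: dahaM_m n = (dahaM_t q k0 k1 k2 k3 i n : M).
Proof. by rewrite [LHS](palg_actE frel) /= lin_extXn. Qed.

End DahaM.

(* Main.v *)
From HB Require Import structures.
Require Import Defs.
From mathcomp Require Import all_boot all_order all_algebra.
From mathcomp Require Import ring boolp.

Set Implicit Arguments.
Unset Strict Implicit.
Unset Printing Implicit Defensive.

Import GRing.Theory.
Local Open Scope ring_scope.

(** The module M(k_0, k_1, k_2, k_3) is universal because its basis is produced
    from m_0 by a recursion that makes sense in every module, and because the
    action of the generators on the vectors so produced is forced by the four
    conditions on the initial vector.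

    Let X_n run through t_0, t_2, t_0, t_2, ... and Y_n through t_1, t_3, t_1,
    t_3, ...; since q^-1 is central, the defining relation of the algebra may
    be rotated, and X_n Y_n X_{n+1} Y_{n+1} = q^-1 for every n.  Starting with
    w_0 = v, put w_{n+1} = w_n - e_{n+1}^-1 X_{n+1} w_n for suitable scalars
    e_n ([ladder]).  All w_n lie in the cyclic submodule generated by v, on
    which the central elements c_i act as scalars.  Hence
    - X_{n+1} w_n is a combination of w_n and w_{n+1} by construction
      ([ladder_up]);
    - X_n w_n is a combination of w_{n-1} and w_n, since X_n sends w_{n-1} into
      their span and is quadratic ([ladder_X]);
    - Y_{n+1} w_n is a multiple of w_n, and Y_n w_n is a combination of w_{n-1},
      w_n and w_{n+1}; both come from the rotated relation, the first by
      induction on n ([ladder_Y_eigen], [ladder_Y]).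
    For a given n the four elements X_n, X_{n+1}, Y_n, Y_{n+1} are all the
    t_i, and the coefficients do not depend on the module.

    The basis vector m_0 satisfies the same four conditions, and the ladder it
    starts is the basis m_n ([dahaM_weight], [dahaM_ladder]).  So the F-linear
    map m_n |-> w_n commutes with every t_i, hence with the whole algebra
    ([dahaM_ext_scale]).  Conversely a homomorphism maps ladders to ladders
    ([ladder_linear]), which gives uniqueness. *)

(** The two structures differ only in proofs of propositions. *)
Lemma linear_eq (R : pzRingType) (U V : lmodType R) (f g : {linear U -> V}) :
  f =1 g -> f = g.
Proof.
case: f g => [f cf] [g cg] /= /funext efg.
move: cf cg; rewrite {}efg => -[[a1] [a2]] [[b1] [b2]].
by rewrite (Prop_irrelevance a1 b1) (Prop_irrelevance a2 b2).
Qed.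

(** * Scalars of the base field and rotation of the defining relation *)

Section RestrictionOfScalars.

Variables (F : fieldType) (q : F) (hq : q != 0) (V : lmodType (daha hq)).

Lemma scalar_scalerA (a b : F) (u : V) : a%:A *: (b%:A *: u) = (a * b)%:A *: u.
Proof. by rewrite scalerA -scalerAl mul1r scalerA. Qed.

Lemma scalar_scalerC (x : daha hq) (a : F) (u : V) :
  x *: (a%:A *: u) = a%:A *: (x *: u).
Proof. by rewrite !scalerA -scalerAl -scalerAr mul1r mulr1. Qed.

Lemma scalar_scalerDl (a b : F) (u : V) :
  (a + b)%:A *: u = a%:A *: u + b%:A *: u.
Proof. by rewrite !scalerDl. Qed.

Lemma scalar_scalerBl (a b : F) (u : V) :
  (a - b)%:A *: u = a%:A *: u - b%:A *: u.
Proof. by rewrite !scalerBl. Qed.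

Lemma scalar_scale0r (u : V) : (0 : F)%:A *: u = 0.
Proof. by rewrite !scale0r. Qed.

Lemma scalar_scale1r (u : V) : (1 : F)%:A *: u = u.
Proof. by rewrite !scale1r. Qed.

Lemma daha_tVK i (u : V) : daha_tV hq i *: (daha_t hq i *: u) = u.
Proof. by rewrite scalerA daha_mulVt scale1r. Qed.

Lemma daha_tK i (u : V) : daha_t hq i *: (daha_tV hq i *: u) = u.
Proof. by rewrite scalerA daha_mulV scale1r. Qed.

Lemma daha_tV_eigen i (a : F) (u : V) : a != 0 ->
  daha_t hq i *: u = a%:A *: u -> daha_tV hq i *: u = a^-1%:A *: u.
Proof.
move=> ha hu; rewrite -[u in LHS]scalar_scale1r -(mulVf ha) -scalar_scalerA -hu.
by rewrite scalar_scalerC daha_tVK.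
Qed.

Lemma daha_prodE (u : V) :
  daha_t hq 0 *: (daha_t hq 1 *: (daha_t hq 2 *: (daha_t hq 3 *: u)))
    = q^-1%:A *: u.
Proof. by rewrite !scalerA daha_prod. Qed.

(** Conjugating the defining relation by t_0 t_1 leaves the central q^-1 fixed. *)
Lemma daha_prod_rot (u : V) :
  daha_t hq 2 *: (daha_t hq 3 *: (daha_t hq 0 *: (daha_t hq 1 *: u)))
    = q^-1%:A *: u.
Proof.
rewrite -[LHS](daha_tVK 1) -[X in _ *: X](daha_tVK 0) daha_prodE.
by rewrite !scalar_scalerC !daha_tVK.
Qed.

End RestrictionOfScalars.

(** * The ladder of a weight vector *)

Section Ladder.

Variables (F : fieldType) (q : F) (hq : q != 0) (k0 k1 k2 k3 : F).
Hypotheses (hk0 : k0 != 0) (hk1 : k1 != 0) (hk2 : k2 != 0) (hk3 : k3 != 0).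

Definition idxX n : 'I_4 := if odd n then 2 else 0.
Definition idxY n : 'I_4 := if odd n then 3 else 1.

(** [eX n] and [eY n] are chosen so that in M(k_0, k_1, k_2, k_3) one has,
    for n > 0, X_n m_{n-1} = eX n (m_{n-1} - m_n) and Y_n m_{n-1} = (eY n)^-1
    m_{n-1}; the central element X_n + X_n^-1 acts there as [cX n], and Y_n +
    Y_n^-1 as eY n + (eY n)^-1.  For n = 0, [eX] is the eigenvalue of t_0^-1 on
    m_0 and [eY] an eigenvalue allowed for t_1. *)
Definition eX n : F :=
  if odd n then k0^-1 * k1^-1 * k3^-1 * q ^- n else k0^-1 * q ^- n.
Definition eY n : F := if odd n then k3^-1 else k1.
Definition cX n : F := if odd n then k2 + k2^-1 else k0 + k0^-1.

Lemma eX_neq0 n : eX n != 0.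
Proof.
by rewrite /eX; case: ifP => _; rewrite !mulf_neq0 ?invr_eq0 ?expf_neq0.
Qed.

Lemma eY_neq0 n : eY n != 0.
Proof. by rewrite /eY; case: ifP => _; rewrite ?invr_eq0. Qed.

(** This makes the factor q^-1 of the rotated relation compatible with the
    coefficients of X_{n+1} and Y_{n+1} on the n-th vector. *)
Lemma eXY n : eX n.+1 * eY n = q^-1 * eX n * eY n.+1.
Proof.
rewrite /eX /eY /= exprS; have := expf_neq0 n hq; move: (q ^+ n) => Q hQ.
by case: (odd n) => /=; field; rewrite ?hQ ?hq ?hk0 ?hk1 ?hk2 ?hk3.
Qed.

Definition weight_vector (V : lmodType (daha hq)) (v : V) : Prop :=
  [/\ daha_t hq 0 *: v = k0%:A *: v,
      daha_t hq 3 *: v = k3%:A *: v,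
      daha_c hq 1 *: v = (k1 + k1^-1)%:A *: v
    & daha_c hq 2 *: v = (k2 + k2^-1)%:A *: v].

Section InModule.

Variables (V : lmodType (daha hq)) (v : V).

Local Notation tX n := (daha_t hq (idxX n)).
Local Notation tXV n := (daha_tV hq (idxX n)).
Local Notation tY n := (daha_t hq (idxY n)).
Local Notation tYV n := (daha_tV hq (idxY n)).

Fixpoint ladder n : V :=
  if n is n'.+1 then
    ladder n' - ((eX n)^-1)%:A *: (tX n *: ladder n')
  else v.

(** The component of X_n w_n along w_{n-1}.  It is kept together with its
    coefficient because for n = 0, where n.-1 = 0, the coefficient vanishes; the
    formulas below then hold for n = 0 without a separate case. *)
Definition ladder_down n : V :=
  (eX n + (eX n)^-1 - cX n)%:A *: ladder n.-1.

Hypothesis hv : weight_vector v.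

Lemma ladder_cyclic n : exists x : daha hq, ladder n = x *: v.
Proof.
elim: n => [|n [x hx]] /=; first by exists 1; rewrite scale1r.
exists (x - ((eX n.+1)^-1)%:A * (tX n.+1 * x)).
by rewrite hx scalerBl !scalerA mulrA.
Qed.

Lemma ladder_central i (c : F) n :
  daha_c hq i *: v = c%:A *: v -> daha_c hq i *: ladder n = c%:A *: ladder n.
Proof.
have [x ->] := ladder_cyclic n => hc.
by rewrite scalerA daha_central -scalerA hc scalar_scalerC.
Qed.

Lemma ladder_cX m n : daha_c hq (idxX m) *: ladder n = (cX m)%:A *: ladder n.
Proof.
have [hv0 _ _ hv2] := hv.
apply: ladder_central; rewrite /idxX /cX; case: ifP => // _.
by rewrite scalerDl (daha_tV_eigen hk0 hv0) hv0 scalar_scalerDl.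
Qed.

Lemma ladder_cY m n :
  daha_c hq (idxY m) *: ladder n = (eY m + (eY m)^-1)%:A *: ladder n.
Proof.
have [_ hv3 hv1 _] := hv.
apply: ladder_central; rewrite /idxY /eY; case: ifP => // _.
rewrite scalerDl (daha_tV_eigen hk3 hv3) hv3 invrK scalar_scalerDl.
exact: addrC.
Qed.

Lemma ladder_up n :
  tX n.+1 *: ladder n = (eX n.+1)%:A *: (ladder n - ladder n.+1).
Proof.
by rewrite /= subKr scalar_scalerA mulfV ?eX_neq0 // scalar_scale1r.
Qed.

(** The inverse of X_n has the simpler coefficients: w_n differs from w_{n-1} by
    a multiple of X_n w_{n-1}, which X_n^-1 sends back to w_{n-1}, while X_n^-1
    w_{n-1} follows from the scalar action of X_n + X_n^-1. *)
Lemma ladder_XV n :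
  tXV n *: ladder n = (eX n)%:A *: ladder n - ladder_down n.
Proof.
have [hv0 _ _ _] := hv.
case: n => [|n]; rewrite /ladder_down.
  rewrite [tXV 0 *: _](daha_tV_eigen hk0 hv0) /eX /cX /= expr0 invr1 mulr1.
  by rewrite invrK [k0^-1 + k0]addrC subrr scalar_scale0r subr0.
have hc := ladder_cX n.+1 n; rewrite scalerDl in hc.
have hV : tXV n.+1 *: ladder n =
    (cX n.+1)%:A *: ladder n - tX n.+1 *: ladder n by rewrite -hc addrC addKr.
rewrite [ladder n.+1 in LHS]/= scalerBr scalar_scalerC daha_tVK hV ladder_up.
rewrite scalar_scalerBl scalar_scalerDl scalerBr [n.+1.-1]/=.
move: (_ *: ladder n) (_ *: ladder n) (_ *: ladder n) (_ *: ladder n.+1) => a b c d.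
rewrite !opprD !opprK !addrA.
by rewrite [RHS]addrC !addrA [c + d - b]addrAC.
Qed.

Lemma ladder_X n :
  tX n *: ladder n
  = (cX n)%:A *: ladder n - ((eX n)%:A *: ladder n - ladder_down n).
Proof. by rewrite -ladder_XV -ladder_cX scalerDl addrK. Qed.

Lemma prodXY n (u : V) :
  tX n *: (tY n *: (tX n.+1 *: (tY n.+1 *: u))) = q^-1%:A *: u.
Proof.
rewrite /idxX /idxY /=; case: (odd n) => /=.
  exact: daha_prod_rot.
exact: daha_prodE.
Qed.

(** Evaluating X_n Y_n X_{n+1} Y_{n+1} = q^-1 at w_n, where Y_{n+1} acts as a
    scalar and X_{n+1} produces w_n - w_{n+1}, determines X_n Y_n (w_n -
    w_{n+1}); it remains to apply the known X_n^-1. *)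
Lemma ladder_Y_diff n :
  tY n.+1 *: ladder n = ((eY n.+1)^-1)%:A *: ladder n ->
  tY n *: (ladder n - ladder n.+1)
  = (eY n)%:A *: (ladder n - ((eX n)^-1)%:A *: ladder_down n).
Proof.
move=> hY; have := prodXY n (ladder n).
rewrite hY !(scalar_scalerC (tX n.+1)) ladder_up !scalar_scalerA !scalar_scalerC.
move=> /(congr1 (fun u => tXV n *: u)); rewrite !scalar_scalerC daha_tVK ladder_XV.
set d := (eY n.+1)^-1 * eX n.+1.
have hd : d != 0 by rewrite mulf_neq0 ?invr_eq0 ?eX_neq0 ?eY_neq0.
move=> /(congr1 (fun u => (d^-1)%:A *: u)).
rewrite !scalar_scalerA mulVf // scalar_scale1r => ->.
(* This is eXY, solved for the ratio eY n / eX n. *)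
have -> : d^-1 / q = eY n / eX n.
  have -> : eY n = q^-1 * eX n * eY n.+1 / eX n.+1.
    by rewrite -eXY mulrC mulKf ?eX_neq0.
  by rewrite /d; field; rewrite ?hq ?eX_neq0 ?eY_neq0.
rewrite -scalar_scalerA; congr (_ *: _).
by rewrite scalerBr !scalar_scalerA mulVf ?eX_neq0 // scalar_scale1r.
Qed.

(** Applying Y_n^-1 to the previous identity gives Y_n^-1 w_n, and Y_n w_n is
    obtained from the scalar action of Y_n + Y_n^-1. *)
Lemma ladder_Y_of_eigen n :
  tY n.+1 *: ladder n = ((eY n.+1)^-1)%:A *: ladder n ->
  tY n *: ladder_down n = ((eY n)^-1)%:A *: ladder_down n ->
  tY n *: ladder n = (eY n)%:A *: ladder n + ((eY n)^-1)%:A *: ladder n.+1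
                     - (eY n / eX n)%:A *: ladder_down n.
Proof.
move=> hY hz; have hb := eY_neq0 n.
have hzV := daha_tV_eigen (invr_neq0 hb) hz; rewrite invrK in hzV.
have hV : tYV n *: ladder n = ((eY n)^-1)%:A *: (ladder n - ladder n.+1)
    + (eY n / eX n)%:A *: ladder_down n.
  have := congr1 (fun u => ((eY n)^-1)%:A *: (tYV n *: u)) (ladder_Y_diff hY).
  rewrite daha_tVK (scalar_scalerC (tYV n)) scalar_scalerA mulVf //.
  rewrite scalar_scale1r => ->.
  by rewrite scalerBr scalar_scalerC hzV scalar_scalerA [_^-1 * _]mulrC subrK.
have -> : tY n *: ladder n =
    (eY n + (eY n)^-1)%:A *: ladder n - tYV n *: ladder n.
  by rewrite -ladder_cY scalerDl addrK.
rewrite hV scalar_scalerDl scalerBr opprD opprB.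
move: (_ *: ladder n) (_ *: ladder n) (_ *: ladder n.+1) (_ *: ladder_down n).
by move=> a b c d; rewrite !addrA; congr (_ - _); rewrite addrAC addrK.
Qed.

Lemma ladder_down0 : ladder_down 0 = 0.
Proof.
rewrite /ladder_down /eX /cX /= expr0 invr1 mulr1 invrK.
by rewrite [k0^-1 + k0]addrC subrr scalar_scale0r.
Qed.

(** At n+1 the first half is the second half at n, as the lowered vector is a
    multiple of w_n.  The second half at n+1 concerns Y_{n+2} = Y_n, whose value
    on w_{n+1} is the difference of [ladder_Y_of_eigen] and [ladder_Y_diff]. *)
Lemma ladder_Y_eigen n :
  tY n *: ladder_down n = ((eY n)^-1)%:A *: ladder_down n /\
  tY n.+1 *: ladder n = ((eY n.+1)^-1)%:A *: ladder n.
Proof.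
have [_ hv3 _ _] := hv.
elim: n => [|n [hz hn]]; first by rewrite ladder_down0 !scaler0 /eY invrK.
split; first by rewrite /ladder_down scalar_scalerC hn !scalar_scalerA mulrC.
have -> : tY n.+2 = tY n by rewrite /idxY /= negbK.
have -> : eY n.+2 = eY n by rewrite /eY /= negbK.
have -> : tY n *: ladder n.+1 =
    tY n *: ladder n - tY n *: (ladder n - ladder n.+1).
  by rewrite scalerBr subKr.
rewrite ladder_Y_of_eigen // ladder_Y_diff // (scalerBr (eY n)%:A).
rewrite (scalar_scalerA (eY n)).
by rewrite opprB addrA subrK addrC addKr.
Qed.

Lemma ladder_Y n : tY n *: ladder n =
  (eY n)%:A *: ladder n + ((eY n)^-1)%:A *: ladder n.+1
  - (eY n / eX n)%:A *: ladder_down n.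
Proof. by have [hz hn] := ladder_Y_eigen n; apply: ladder_Y_of_eigen. Qed.

End InModule.

(** The source of uniqueness: the ladder is defined by the module structure. *)
Lemma ladder_linear (V W : lmodType (daha hq)) (f : {linear V -> W}) v n :
  f (ladder v n) = ladder (f v) n.
Proof. by elim: n => //= n IHn; rewrite linearB !linearZ /= IHn. Qed.

(** * The ladder of M(k_0, k_1, k_2, k_3) and the universal map *)

Local Notation M := (dahaM hq hk0 hk1 hk2 hk3).
Local Notation m := (dahaM_m hq hk0 hk1 hk2 hk3).

Lemma scale_subKr (e : F) (a b : {poly F}) : e != 0 ->
  a - e^-1 *: (e *: (a - b)) = b.
Proof. by move=> he; rewrite scalerA mulVf // scale1r subKr. Qed.

(** The formulas for t_2 on even and t_0 on odd basis vectors, solved for the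
    next basis vector, are the recursion of the ladder. *)
Lemma dahaM_ladder n : ladder (m 0) n = m n.
Proof.
elim: n => //= n ->; rewrite dahaM_tE dahaM_scalE.
have := eX_neq0 n.+1; rewrite /idxX /eX /dahaM_t /=.
case: (boolP (odd n)) => o /= he.
  rewrite /dahaM_t0 o; case: eqP o => [-> //|_ _]; exact: scale_subKr.
by rewrite /dahaM_t2 (negbTE o); apply: scale_subKr.
Qed.

Lemma dahaM_c i (p : M) : daha_c hq i *: p =
  (dahaM_k k0 k1 k2 k3 i + (dahaM_k k0 k1 k2 k3 i)^-1)%:A *: p.
Proof.
have frel := dahaM_op_rel hq hk0 hk1 hk2 hk3.
rewrite dahaM_scalE scalerDl /daha_t /daha_tV.
rewrite [X in X + _](palg_actE frel) [X in _ + X](palg_actE frel) /=.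
exact: subrKC.
Qed.

Lemma dahaM_weight : weight_vector (m 0).
Proof.
split; [by rewrite dahaM_tE dahaM_scalE | by rewrite dahaM_tE dahaM_scalE | |].
- exact: (dahaM_c 1).
- exact: (dahaM_c 2).
Qed.

Lemma dahaM_expand (p : {poly F}) :
  (p : M) = \sum_(i < size p) (p`_i)%:A *: m i.
Proof.
rewrite -[LHS]coefK poly_def; apply: eq_bigr => i _.
by rewrite dahaM_scalE.
Qed.

Section Extension.

Variables (V : lmodType (daha hq)) (w : nat -> V).

Definition dahaM_ext (p : M) : V :=
  \sum_(i < size (p : {poly F})) ((p : {poly F})`_i)%:A *: w i.

Lemma dahaM_ext_widen (p : {poly F}) n : (size p <= n)%N ->
  dahaM_ext p = \sum_(i < n) (p`_i)%:A *: w i.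
Proof.
move=> hn; rewrite /dahaM_ext.
rewrite (big_ord_widen _ (fun i => (p`_i)%:A *: w i) hn) big_mkcond.
apply: eq_bigr => i _.
by case: ltnP => // h; rewrite nth_default ?scalar_scale0r.
Qed.

Lemma dahaM_extD (p r : M) : dahaM_ext (p + r) = dahaM_ext p + dahaM_ext r.
Proof.
pose s := [:: size (p + r : {poly F}); size (p : {poly F}); size (r : {poly F})].
pose n := \max_(i <- s) i.
have hn i : i \in s -> (i <= n)%N by move=> hi; apply: leq_bigmax_seq.
rewrite !(@dahaM_ext_widen _ n) ?hn ?inE ?eqxx ?orbT // -big_split /=.
by apply: eq_bigr => i _; rewrite coefD scalar_scalerDl.
Qed.

Lemma dahaM_extZ (a : F) (p : M) : dahaM_ext (a%:A *: p) = a%:A *: dahaM_ext p.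
Proof.
rewrite dahaM_scalE (dahaM_ext_widen (size_scale_leq a p)) scaler_sumr.
by apply: eq_bigr => i _; rewrite coefZ scalar_scalerA.
Qed.

Lemma dahaM_ext_m n : dahaM_ext (m n) = w n.
Proof.
rewrite /dahaM_ext size_polyXn big_ord_recr /= coefXn eqxx scalar_scale1r.
rewrite big1 ?add0r // => i _.
by rewrite coefXn ltn_eqF // scalar_scale0r.
Qed.

End Extension.

Section Universal.

Variables (V : lmodType (daha hq)) (v : V).
Hypothesis hv : weight_vector v.

Let f := dahaM_ext (ladder v).

Lemma idx_cover n i :
  [\/ i = idxX n, i = idxX n.+1, i = idxY n | i = idxY n.+1].
Proof.
rewrite /idxX /idxY /=; case: (odd n); move: i; apply: ord4_ind => /=;
  by [apply: Or41 | apply: Or42 | apply: Or43 | apply: Or44].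
Qed.

(** The ladder formulas apply to m_n, a ladder vector of M, as well as to its
    image, and have the same coefficients in both modules. *)
Lemma dahaM_ext_t_m i n :
  f (daha_t hq i *: m n) = daha_t hq i *: ladder v n.
Proof.
have fD p r : f (p + r) = f p + f r by exact: dahaM_extD.
have fZ a p : f (a%:A *: p) = a%:A *: f p by exact: dahaM_extZ.
have fN p : f (- p) = - f p.
  by apply/eqP; rewrite -addr_eq0 -fD addNr /f /dahaM_ext size_poly0 big_ord0.
have fm k : f (ladder (m 0) k) = ladder v k.
  by rewrite dahaM_ladder /f dahaM_ext_m.
have fdown k : f (ladder_down (m 0) k) = ladder_down v k.
  by rewrite /ladder_down fZ fm.
have hm := dahaM_weight.
rewrite -dahaM_ladder.
case: (idx_cover n i) => ->.
- by rewrite !ladder_X // !(fdown, fm, fD, fN, fZ).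
- by rewrite !ladder_up // !(fdown, fm, fD, fN, fZ).
- by rewrite !ladder_Y // !(fdown, fm, fD, fN, fZ).
- by rewrite (ladder_Y_eigen hm n).2 (ladder_Y_eigen hv n).2 fZ fm.
Qed.

Lemma dahaM_ext_t i (p : M) : f (daha_t hq i *: p) = daha_t hq i *: f p.
Proof.
rewrite [p in LHS]dahaM_expand [p in RHS]dahaM_expand.
rewrite scaler_sumr.
have fsum (g : 'I_(size (p : {poly F})) -> M) : f (\sum_i g i) = \sum_i f (g i).
  apply: (big_morph f); first exact: dahaM_extD.
  by rewrite /f /dahaM_ext size_poly0 big_ord0.
rewrite !fsum scaler_sumr; apply: eq_bigr => j _.
have fZ a r : f (a%:A *: r) = a%:A *: f r by exact: dahaM_extZ.
rewrite scalar_scalerC !fZ dahaM_ext_t_m /f dahaM_ext_m.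
by rewrite scalar_scalerC.
Qed.

(** Commutation with t_i entails commutation with its inverse, so the generators
    of the algebra are all covered. *)
Lemma dahaM_ext_scale (x : daha hq) : forall p : M, f (x *: p) = x *: f p.
Proof.
elim/daha_ind: x => [a|i|i|x y hx hy|x y hx hy] p.
- exact: dahaM_extZ.
- exact: dahaM_ext_t.
- by rewrite -[f (_ *: p)](daha_tVK i) -dahaM_ext_t daha_tK.
- by rewrite !scalerDl [f (_ + _)]dahaM_extD -!/(f _) hx hy.
- by rewrite -!scalerA hx hy.
Qed.

End Universal.
End Ladder.

Theorem theorem3p6 (F : fieldType) (q : F) (hq : q != 0)
    (k0 k1 k2 k3 : F)
    (hk0 : k0 != 0) (hk1 : k1 != 0) (hk2 : k2 != 0) (hk3 : k3 != 0)
    (V : lmodType (daha hq)) (v : V) :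
  daha_t hq 0 *: v = k0%:A *: v ->
  daha_t hq 3 *: v = k3%:A *: v ->
  daha_c hq 1 *: v = (k1 + k1^-1)%:A *: v ->
  daha_c hq 2 *: v = (k2 + k2^-1)%:A *: v ->
  exists! f : {linear dahaM hq hk0 hk1 hk2 hk3 -> V},
    f (dahaM_m hq hk0 hk1 hk2 hk3 0) = v.
Proof.
move=> hv0 hv3 hv1 hv2.
have hv : weight_vector k0 k1 k2 k3 v by split.
pose f : dahaM hq hk0 hk1 hk2 hk3 -> V := dahaM_ext (ladder k0 k1 k3 v).
have f_linear : linear f.
  move=> x p r; rewrite /f dahaM_extD; congr (_ + _).
  exact: dahaM_ext_scale hv x p.
pose fL : {linear dahaM hq hk0 hk1 hk2 hk3 -> V} :=
  HB.pack f (GRing.isLinear.Build _ _ _ _ f f_linear).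
exists fL; split=> [|g hg]; first exact: dahaM_ext_m.
apply: linear_eq => p.
rewrite [p in RHS]dahaM_expand linear_sum; apply: eq_bigr => i _.
by rewrite linearZ /= -dahaM_ladder ladder_linear hg.
Qed.
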